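(* Let $x_1,\dots,x_n,a,b$ be distinct integers and let $f\colon\{x_1,\dots,x_n,a,b\}\to\mathbb Z$ be a function whose interpolation polynomial (the unique polynomial in $\mathbb Q[x]$ of degree at most $n+1$ agreeing with $f$ on these $n+2$ points) is not in $\mathbb Z[x]$, while the restrictions of $f$ to $\{x_1,\dots,x_n,a\}$ and to $\{x_1,\dots,x_n,b\}$ are each given by some polynomial in $\mathbb Z[x]$. Then: (1) $|a-b|\ge 2$; (2) letting $V=\{x\in\mathbb Z:\gcd(x-a,a-b)=1\}$ and $U=\{x_1,\dots,x_n\}\cup V$, there exists a function $g\colon U\cup\{a,b\}\to\mathbb Z$ that agrees with $f$ on $\{x_1,\dots,x_n,a,b\}$ and whose restrictions to $U\cup\{a\}$ and to $U\cup\{b\}$ are LIP.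
   Context: For $S\subseteq\mathbb Z$, a function $h\colon S\to\mathbb Z$ is LIP on $S$ if for every finite $X\subseteq S$ there is $p\in\mathbb Z[x]$ with $p(x)=h(x)$ for all $x\in X$. (Note $a,b\notin V$.) *)

(* Defs.v *)
From HB Require Import structures.
From mathcomp Require Import all_boot all_order all_algebra.
From mathcomp Require Import boolp classical_sets cardinality.
Set Implicit Arguments.
Unset Strict Implicit.
Unset Printing Implicit Defensive.
Import Order.TTheory GRing.Theory Num.Theory.
Local Open Scope classical_set_scope.
Local Open Scope ring_scope.

(* A function S -> Z is represented by a total function int -> int of which
   only the values on S are constrained, so the restriction of h to a smaller
   set is h itself, considered on that set. *)
Definition poly_on (S : set int) (h : int -> int) : Prop :=
  exists p : {poly int}, forall x, S x -> p.[x] = h x.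

Definition LIP (S : set int) (h : int -> int) : Prop :=
  forall X : set int, finite_set X -> X `<=` S -> poly_on X h.

(* For a duplicate-free s, this characterizes exactly one P: the bound on
   size P says that the degree of P is at most size s - 1. *)
Definition interpolation_poly (s : seq int) (f : int -> int)
    (P : {poly rat}) : Prop :=
  (size P <= size s)%N /\ {in s, forall y, P.[y%:~R] = (f y)%:~R}.

(* Main.v *)
(** Let [A] and [B] be integer polynomials giving [f] on the [x_i] together with
    [a], resp. [b], and let [Q] be the product of the [X - x_i]; then [Q] divides
    [A - B], say [A - B = D * Q]. Adding [s * Q * (X - a)] to [A] and
    [t * Q * (X - b)] to [B] changes neither the values at the [x_i], nor [A] at
    [a], nor [B] at [b], but it changes [D] into [D + s (X - a) - t (X - b)].
    If [|a - b| = 1] one can make this vanish at [b], so that a single integer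
    polynomial gives [f] everywhere; reducing it modulo a monic polynomial shows
    that the interpolation polynomial is integral. If [v - a] and [v - b] are
    coprime, which means that [v] is in [V], Bezout makes it vanish at [v]; then
    [A] and [B] also agree at [v]. Iterating over an enumeration of [V] makes
    the values of [A] stabilize at each point of [V], which defines [g]. *)

Require Import Defs.
From HB Require Import structures.
From mathcomp Require Import all_boot all_order all_algebra.
From mathcomp Require Import zify ring.
From mathcomp Require Import boolp classical_sets cardinality.
Set Implicit Arguments.
Unset Strict Implicit.
Unset Printing Implicit Defensive.
Import Order.TTheory GRing.Theory Num.Theory.
Local Open Scope classical_set_scope.
Local Open Scope ring_scope.

Lemma dvd_prod_XsubC (R : idomainType) (s : seq R) (p : {poly R}) :
  uniq s -> {in s, forall y, p.[y] = 0} ->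
  exists q, p = q * \prod_(y <- s) ('X - y%:P).
Proof.
elim: s p => [|z s IHs] p /=; first by exists p; rewrite big_nil mulr1.
case/andP=> z_s uniq_s p_s.
have /factor_theorem[q def_p] : root p z by apply/rootP/p_s/mem_head.
have [|r def_q] := IHs q uniq_s.
  move=> y y_s; apply/eqP; have /eqP := p_s y (mem_behead (s := z :: s) y_s).
  rewrite def_p hornerM hornerXsubC mulf_eq0 subr_eq0 => /orP[//|/eqP eq_yz].
  by rewrite -eq_yz y_s in z_s.
by exists r; rewrite def_p def_q big_cons -mulrA [_ * ('X - _)]mulrC.
Qed.

(** The remainder of [p] modulo the monic [m] stays integral and keeps the values on [s]; its
    difference with [P] has more roots than its degree allows. *)
Lemma interpolation_poly_int (s : seq int) (f : int -> int) (P : {poly rat}) :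
  uniq s -> interpolation_poly s f P -> poly_on [set` s] f ->
  P \is a polyOver Num.int.
Proof.
move=> uniq_s [sizeP P_f] [p p_f].
pose m := \prod_(y <- s) ('X - y%:P : {poly int}).
have m_monic : m \is monic by exact: monic_prod_XsubC.
pose r := Pdiv.CommonRing.rmodp p m.
have size_r : (size r <= size s)%N.
  by rewrite -ltnS -(size_prod_XsubC s id) Pdiv.CommonRing.ltn_rmodpN0 ?monic_neq0.
have r_f y : y \in s -> r.[y] = f y.
  move=> y_s; rewrite -p_f // [in RHS](Pdiv.RingMonic.rdivp_eq m_monic p).
  have /rootP m_y : root m y by rewrite root_prod_XsubC.
  by rewrite hornerD hornerM m_y mulr0 add0r.
suff -> : P = map_poly intr r.
  by apply/polyOverP => i; rewrite coef_map /= intr_int.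
apply/eqP; rewrite -subr_eq0; apply/eqP.
apply: (@roots_geq_poly_eq0 _ _ [seq y%:~R | y <- s]).
- apply/allP => _ /mapP[y y_s ->]; apply/rootP.
  by rewrite hornerD hornerN horner_map /= P_f // r_f // subrr.
- by rewrite map_inj_uniq //; exact: intr_inj.
rewrite size_map (leq_trans (size_polyD _ _)) // size_polyN geq_max sizeP.
by rewrite (leq_trans (size_poly _ _)).
Qed.

Lemma glue_step (a b v : int) (A B Q : {poly int}) :
  coprimez (v - a) (v - b) -> (exists D, A - B = D * Q) ->
  exists s t : int, exists D,
    (A + s *: (Q * ('X - a%:P))) - (B + t *: (Q * ('X - b%:P)))
      = D * (Q * ('X - v%:P)).
Proof.
move=> /coprimezP[[u w] /= bezout] [D defD].
(* Chosen so that [s * (v - a) - t * (v - b)] is [- D.[v]] by Bezout. *)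
pose s := - D.[v] * u; pose t := D.[v] * w.
have /factor_theorem[D' defD'] :
    root (D + s *: ('X - a%:P) - t *: ('X - b%:P)) v.
  apply/rootP; rewrite !(hornerD, hornerN, hornerZ, hornerX, hornerC).
  have -> : D.[v] + s * (v - a) - t * (v - b)
          = D.[v] * (1 - (u * (v - a) + w * (v - b))) by rewrite /s /t; ring.
  by rewrite bezout subrr mulr0.
exists s, t, D'; rewrite [Q * _ in RHS]mulrC mulrA -defD'.
have -> : A = B + D * Q by rewrite -defD addrC subrK.
by rewrite -!mul_polyC; ring.
Qed.

(** Repetitions in [e] only raise multiplicities, so [e] need not be injective. *)
Definition nodes (Q : {poly int}) (e : nat -> int) (k : nat) : {poly int} :=
  Q * \prod_(i < k) ('X - (e i)%:P).

Lemma nodesS Q e k : nodes Q e k.+1 = nodes Q e k * ('X - (e k)%:P).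
Proof. by rewrite /nodes big_ord_recr mulrA. Qed.

Lemma root_nodes_leq Q e k l y :
  (k <= l)%N -> (nodes Q e k).[y] = 0 -> (nodes Q e l).[y] = 0.
Proof.
move=> /subnK <-; elim: (l - k)%N => //= d IHd /IHd Qy.
by rewrite addSn nodesS hornerM Qy mul0r.
Qed.

Lemma root_nodes Q e k y : (exists2 i, (i < k)%N & e i = y) ->
  (nodes Q e k).[y] = 0.
Proof.
move=> [i lt_ik <-]; apply: (root_nodes_leq lt_ik).
by rewrite nodesS hornerM hornerXsubC subrr mulr0.
Qed.

Lemma glue_seq (a b : int) (e : nat -> int) (A0 B0 Q : {poly int}) :
  (forall i, coprimez (e i - a) (e i - b)) -> (exists D, A0 - B0 = D * Q) ->
  exists A B : nat -> {poly int},
    [/\ A 0%N = A0,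
        forall k, (A k).[a] = A0.[a] /\ (B k).[b] = B0.[b],
        forall k, exists D, A k - B k = D * nodes Q e k
      & forall k y, (nodes Q e k).[y] = 0 -> (A k.+1).[y] = (A k).[y]].
Proof.
move=> coprime_e divQ.
(* Divisibility is assumed under the existential so that [choice] gives a total function, with
   [(0, 0)] as default. *)
have step (z : nat * ({poly int} * {poly int})) :
  exists st : int * int, (exists D, z.2.1 - z.2.2 = D * nodes Q e z.1) ->
    exists D,
      (z.2.1 + st.1 *: (nodes Q e z.1 * ('X - a%:P)))
        - (z.2.2 + st.2 *: (nodes Q e z.1 * ('X - b%:P)))
      = D * nodes Q e z.1.+1.
  have [divz|] := pselect (exists D, z.2.1 - z.2.2 = D * nodes Q e z.1).
    have [s [t stP]] := glue_step (coprime_e z.1) divz.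
    by exists (s, t); rewrite nodesS.
  by exists (0, 0).
have {step}[c cP] := choice step.
pose next k (z : {poly int} * {poly int}) :=
  (z.1 + (c (k, z)).1 *: (nodes Q e k * ('X - a%:P)),
   z.2 + (c (k, z)).2 *: (nodes Q e k * ('X - b%:P))).
pose st k := iteri k next (A0, B0).
exists (fun k => (st k).1), (fun k => (st k).2); split => //.
- elim=> [//|k [IHa IHb]] /=.
  rewrite !hornerD !hornerZ !hornerM !hornerXsubC IHa IHb.
  by rewrite !subrr !mulr0 !addr0.
- elim=> [|k IHk]; first by rewrite /nodes big_ord0 mulr1.
  exact: (cP (k, st k)).
by move=> k y Qy /=; rewrite hornerD hornerZ hornerM Qy mul0r mulr0 addr0.
Qed.

(** On a finite set, the member of [A] at the largest threshold [N y] fits every value. *)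
Lemma LIP_of_seq (S : set int) (g : int -> int) (N : int -> nat)
    (A : nat -> {poly int}) :
  (forall y k, S y -> (N y <= k)%N -> (A k).[y] = g y) -> LIP S g.
Proof.
move=> A_g X /finite_seqP[s ->] sS; exists (A (\max_(y <- s) N y)) => y /= y_s.
by apply: A_g; [exact: sS | exact: leq_bigmax_seq].
Qed.

Theorem theorem8 (n : nat) (x : n.-tuple int) (a b : int)
    (x_a_b_distinct : uniq [:: a, b & x])
    (f : int -> int) (P : {poly rat})
    (P_interp : interpolation_poly [:: a, b & x] f P)
    (P_nonint : P \isn't a polyOver Num.int)
    (f_xa : poly_on [set` a :: x] f)
    (f_xb : poly_on [set` b :: x] f) :
  2 <= `|a - b| /\
  (let V := [set y : int | gcdz (y - a) (a - b) = 1] in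
   let U := [set` x] `|` V in
   exists g : int -> int,
     [/\ {in [:: a, b & x], g =1 f},
         LIP (U `|` [set a]) g
       & LIP (U `|` [set b]) g]).
Proof.
have [pa pa_f] := f_xa; have [pb pb_f] := f_xb.
pose Q : {poly int} := \prod_(y <- x) ('X - y%:P).
have uniq_x : uniq x by case/and3P: x_a_b_distinct.
have neq_ab : a != b.
  by case/andP: x_a_b_distinct; rewrite inE negb_or => /andP[].
have Q_x y : y \in tval x -> Q.[y] = 0.
  by move=> y_x; apply/rootP; rewrite root_prod_XsubC.
have divQ : exists D, pa - pb = D * Q.
  apply: dvd_prod_XsubC => // y y_x.
  by rewrite hornerD hornerN pa_f ?pb_f ?subrr //= inE y_x orbT.
have ge2_ab : 2 <= `|a - b|.
  rewrite leNgt; apply/negP => lt2; case/negP: P_nonint.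
  have sq1 : (a - b) * (a - b) = 1.
    have : a - b = 1 \/ a - b = -1 by lia.
    by case=> ->.
  have [D defD] := divQ.
  apply: (interpolation_poly_int x_a_b_distinct P_interp).
  (* At [b] the added term is [- D.[b] * Q.[b] * (a - b) ^ 2], which cancels [pa.[b] - pb.[b]]
     because [(a - b) ^ 2 = 1]. *)
  exists (pa + (D.[b] * (a - b)) *: (Q * ('X - a%:P))) => y /=.
  rewrite !inE hornerD hornerZ hornerM hornerXsubC.
  case/or3P=> [/eqP->|/eqP->|y_x].
  - by rewrite subrr !mulr0 addr0 pa_f //= mem_head.
  - rewrite -pb_f /= ?mem_head // -[pa](subrK pb) defD hornerD hornerM.
    transitivity (pb.[b] + D.[b] * Q.[b] * (1 - (a - b) * (a - b))).
      by ring.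
    by rewrite sq1 subrr mulr0 addr0.
  - by rewrite Q_x // mul0r mulr0 addr0 pa_f //= inE y_x orbT.
split=> // V U.
have VE y : V y <-> coprimez (y - a) (y - b).
  rewrite /coprimez (_ : y - b = (y - a) + (a - b)) ?gcdzDl; last by ring.
  by split=> /eqP.
(* [V] contains [a + 1], which serves as a filler in its enumeration. *)
pose e i : int := if unpickle i is Some y then
  if coprimez (y - a) (y - b) then y else a + 1 else a + 1.
have eP i : coprimez (e i - a) (e i - b).
  have co_a1 : coprimez (a + 1 - a) (a + 1 - b).
    by rewrite addrAC subrr add0r /coprimez gcd1z.
  by rewrite /e; case: (unpickle i) => // y; case: ifP.
have [A [B [A0 AB_ab divAB stepA]]] := glue_seq eP divQ.
have stableA y k l : (k <= l)%N -> (nodes Q e k).[y] = 0 ->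
    (A l).[y] = (A k).[y].
  move=> /subnK <- Qy; elim: (l - k)%N => // d IHd.
  by rewrite addSn stepA // (root_nodes_leq _ Qy) // leq_addl.
have nodes_x k y : y \in tval x -> (nodes Q e k).[y] = 0.
  by move=> y_x; rewrite hornerM Q_x ?mul0r.
have nodes_V y k : V y -> (pickle y < k)%N -> (nodes Q e k).[y] = 0.
  move=> /VE Vy lt_yk; apply: root_nodes; exists (pickle y) => //.
  by rewrite /e pickleK Vy.
have nodes_U y k : U y -> (pickle y < k)%N -> (nodes Q e k).[y] = 0.
  by case=> [y_x _|Vy lt_yk]; [exact: nodes_x|exact: nodes_V].
have AB_U y k : U y -> (pickle y < k)%N -> (A k).[y] = (B k).[y].
  move=> Uy lt_yk; have [D defD] := divAB k; apply/eqP.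
  by rewrite -subr_eq0 -hornerN -hornerD defD hornerM nodes_U ?mulr0.
(* A point [y] of [V] is the node of index [pickle y], so the values of [A] at [y] are constant from
   the next index on. *)
pose g y := if y \in [:: a, b & x] then f y else (A (pickle y).+1).[y].
(* At [a] and at [b] the gcd defining [V] equals [|a - b|], which is at least 2. *)
have V_ab y : V y -> (y == a) || (y == b) = false.
  move=> Vy; apply/negP => /orP[] /eqP eq_y; move: Vy; rewrite /V eq_y /=.
    by rewrite subrr gcd0z; lia.
  by rewrite -opprB gcdNz gcdzz; lia.
have A_U y k : U y -> (pickle y < k)%N -> (A k).[y] = g y.
  move=> Uy lt_yk; rewrite /g !inE orbA.
  case: (boolP (y \in tval x)) => [y_x|y_nx].
    rewrite orbT (@stableA y 0) ?nodes_x // A0 pa_f //=.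
    by rewrite inE y_x orbT.
  case: Uy => [y_x|Vy]; first by rewrite y_x in y_nx.
  by rewrite (V_ab y Vy) /= (stableA _ _ _ lt_yk) ?nodes_V.
have g_f : {in [:: a, b & x], g =1 f} by move=> y y_s; rewrite /g y_s.
exists g; split=> //.
  apply: (@LIP_of_seq _ _ (fun y => (pickle y).+1) A) => y k [Uy|->] lt_yk.
    exact: A_U.
  by rewrite (AB_ab k).1 g_f ?pa_f //= ?inE eqxx.
(* [B] takes the same eventual values as [A] on [U], but has the right value at [b]. *)
apply: (@LIP_of_seq _ _ (fun y => (pickle y).+1) B) => y k [Uy|->] lt_yk.
  by rewrite -AB_U ?A_U.
by rewrite (AB_ab k).2 g_f ?pb_f //= ?inE eqxx ?orbT.
Qed.
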